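(* Let $D_2$ be a discrete derivative operator approximating the second derivative with order of accuracy $p>2$. Then $D_2$ is not dissipative for every entropy; that is, there exist an entropy $U$ (a convex differentiable function $U\colon\mathbb{R}\to\mathbb{R}$) and a scalar-valued grid function $\mathbf{u}$ such that $$\sum_i U'(\mathbf{u}_i)\,(D_2\mathbf{u})_i>0.$$
   Context: Consider a finite, possibly non-uniform grid with distinct nodes $x_i\in\mathbb{R}$. A grid function is a family $\mathbf{u}=(\mathbf{u}_i)_i$ of values at the nodes. A (linear) discrete approximation $D_2$ of the second derivative has, at each node $x_j$, the form $(D_2\mathbf{u})_j=\sum_k c_k\mathbf{u}_{j+k}$ with real coefficients $c_k$ (which may depend on $j$), the sum being over offsets $k$ with $x_{j+k}$ a grid node. (On periodic grids, the positions $x_{j+k}$ are understood in the periodic extension of the grid and different offsets $k$ in the stencil refer to different nodes.) It has order of accuracy $p$ if at every node it satisfies the order conditions from Taylor expansion, i.e. it is exact for polynomials of degree $\le p+1$: $\sum_k c_k (x_{j+k}-x_j)^l$ equals $2$ for $l=2$ and $0$ for all other $l\in\{0,1,\dots,p+1\}$. For a scalar problem an entropy is a convex function $U$ with derivative $U'$, and $D_2$ is dissipative for $U$ if $\sum_i U'(\mathbf{u}_i)(D_2\mathbf{u})_i\le0$ for all grid functions $\mathbf{u}$. *)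

(* Defs.v *)
From HB Require Import structures.
From mathcomp Require Import all_boot all_order all_algebra.
From mathcomp Require Import all_classical all_reals all_analysis.
Import Order.TTheory GRing.Theory Num.Theory.
Import numFieldNormedType.Exports.

Set Implicit Arguments.
Unset Strict Implicit.
Unset Printing Implicit Defensive.

Local Open Scope ring_scope.

(* Index in 0, ..., N of the node that the integer index m refers to. *)
Definition node_index (N : nat) (m : int) : 'I_N.+1 :=
  inord `|(m %% N.+1%:Z)%Z|%N.

(* Position x_m: the family x_0, ..., x_N is extended to integer indices by
   x_(m + (N + 1)) = x_m + L. *)
Definition extend (R : realType) (N : nat) (x : 'I_N.+1 -> R) (L : R)
    (m : int) : R :=
  x (node_index N m) + L *~ (m %/ N.+1%:Z)%Z.

(* [period = None] is a grid on an interval, where only the integer indices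
   0, ..., N denote nodes; [period = Some L] is a periodic grid with period L,
   where every integer index does. The nodes need not be sorted. *)
Record grid (R : realType) (N : nat) := Grid {
  node : 'I_N.+1 -> R;
  period : option R;
  period_gt0 : forall L, period = Some L -> 0 < L;
  node_distinct : if period is Some L then injective (extend node L)
                  else injective node }.

Definition is_index (R : realType) (N : nat) (G : grid R N) (m : int) : bool :=
  if period G is Some _ then true else (0 <= m < N.+1%:Z).

(* When [period G = None], the value outside of [is_index G] is irrelevant. *)
Definition position (R : realType) (N : nat) (G : grid R N) (m : int) : R :=
  if period G is Some L then extend (node G) L m else node G (node_index N m).

(* [stencil D j] lists the offsets k used at node j. The last field says that
   different offsets of a stencil refer to different nodes; it also excludes
   repetitions in the list. *)
Record discrete_op (R : realType) (N : nat) (G : grid R N) := DiscreteOp {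
  stencil : 'I_N.+1 -> seq int;
  coef : 'I_N.+1 -> int -> R;
  stencil_index : forall (j : 'I_N.+1) (k : int),
    k \in stencil j -> is_index G (j%:Z + k);
  stencil_uniq : forall j : 'I_N.+1,
    uniq [seq node_index N (j%:Z + k) | k <- stencil j] }.

Definition apply_op (R : realType) (N : nat) (G : grid R N)
    (D : discrete_op G) (u : 'I_N.+1 -> R) (j : 'I_N.+1) : R :=
  \sum_(k <- stencil D j) coef D j k * u (node_index N (j%:Z + k)).

Definition second_derivative_order (R : realType) (N : nat) (G : grid R N)
    (D : discrete_op G) (p : nat) : Prop :=
  forall (j : 'I_N.+1) (l : nat), (l <= p.+1)%N ->
    \sum_(k <- stencil D j)
      coef D j k * (position G (j%:Z + k) - position G j%:Z) ^+ l
    = if l == 2%N then 2 else 0.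

Definition entropy (R : realType) (U : R -> R) : Prop :=
  convex_function [set: R] U /\ forall v : R, derivable U v 1.

(* Main.v *)
Require Import Defs.
From HB Require Import structures.
From mathcomp Require Import all_boot all_order all_algebra.
From mathcomp Require Import all_classical all_reals all_analysis.
From mathcomp Require Import ring lra.
Import Order.TTheory GRing.Theory Num.Theory.
Import numFieldNormedType.Exports.

Set Implicit Arguments.
Unset Strict Implicit.
Unset Printing Implicit Defensive.

Local Open Scope ring_scope.

(** Order at least 3 forces the fourth moment of every row of the operator to
    vanish while its second moment is 2, so the row of a node [j] cannot be
    nonnegative away from [j] ([exists_negative_offdiag]). If [n] is a node other
    than [j] whose coefficient is negative, let the grid function take the value
    1 at [j], a very negative value at [n], and 0 elsewhere: its discrete second
    derivative at its maximum [j] is then positive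
    ([exists_peak_with_positive_apply_op]). The entropy [expR (a * x)] with [a]
    large weights the node [j] by [a * expR a] and every other node by at most
    [a], so that the contribution of [j] decides the sign of the sum. *)

(** If the moments of order 0, 2 and 4 of a list of coefficients [c k] placed
    at [h k] are 0, 2 and 0, then for every [a >= 0] the polynomial
    [(x ^+ 2 - a) ^+ 2] has integral [- 4 a <= 0]. As this polynomial is
    nonnegative and vanishes where [x ^+ 2 = a], some coefficient away from
    these points is negative if [a > 0]; for [a = 0], if there were none, then
    the vanishing fourth moment would make the second moment vanish too. *)
Lemma exists_negative_coef (R : realDomainType) (I : eqType) (s : seq I)
    (c h : I -> R) (a : R) :
  0 <= a -> \sum_(k <- s) c k = 0 -> \sum_(k <- s) c k * h k ^+ 2 = 2 ->
  \sum_(k <- s) c k * h k ^+ 4 = 0 ->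
  exists k, [/\ k \in s, h k ^+ 2 != a & c k < 0].
Proof.
move=> a_ge0 m0 m2 m4.
have [/hasP[k ks /andP[ha cneg]]|/hasPn noneg] :=
    boolP (has (fun k => (h k ^+ 2 != a) && (c k < 0)) s); first by exists k.
have term_ge0 k : k \in s -> 0 <= c k * (h k ^+ 2 - a) ^+ 2.
  move=> /noneg; rewrite negb_and negbK -leNgt => /orP[/eqP->|c_ge0].
    by rewrite subrr expr0n mulr0.
  by rewrite mulr_ge0 ?sqr_ge0.
have sumE : \sum_(k <- s) c k * (h k ^+ 2 - a) ^+ 2 = - (4 * a).
  transitivity (\sum_(k <- s) (c k * h k ^+ 4 - 2 * a * (c k * h k ^+ 2)
      + a ^+ 2 * c k)); first by apply: eq_bigr => k _; ring.
  rewrite big_split sumrB -!mulr_sumr m0 m2 m4 /=; ring.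
have sum_ge0 : 0 <= \sum_(k <- s) c k * (h k ^+ 2 - a) ^+ 2.
  by rewrite big_seq; apply: sumr_ge0.
have a0 : a = 0 by lra.
move: sumE; rewrite a0 mulr0 oppr0 big_seq => /eqP.
rewrite psumr_eq0 => [/allP term0|k /term_ge0]; last by rewrite a0 subr0 addr0.
suff m2_0 : \sum_(k <- s) c k * h k ^+ 2 = 0 by lra.
rewrite big_seq big1 // => k ks; apply/eqP.
have := term0 _ ks; rewrite ks addr0 /= mulf_eq0 !expf_eq0 /=.
by case/orP => /eqP->; rewrite ?expr0n ?mul0r ?mulr0.
Qed.

Lemma map_uniq_inj_in (T1 T2 : eqType) (f : T1 -> T2) (s : seq T1) :
  uniq (map f s) -> {in s &, injective f}.
Proof.
move=> us x y xs ys fxy; rewrite -(nth_index x xs) -(nth_index x ys).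
congr (nth x s _); apply/eqP.
rewrite -(nth_uniq (f x) _ _ us) ?size_map ?index_mem //.
by rewrite !(nth_map x) ?index_mem // !nth_index // fxy.
Qed.

(** At every node, an operator of order at least 3 has a negative coefficient
    at another node. On a periodic grid an offset may lead back to the node
    itself with a nonzero displacement, hence the need for the parameter [a]
    in [exists_negative_coef]. *)
Lemma exists_negative_offdiag (R : realType) (N : nat) (G : grid R N)
    (D : discrete_op G) (p : nat) (j : 'I_N.+1) :
  (2 < p)%N -> second_derivative_order D p ->
  exists k, [/\ k \in stencil D j, node_index N (j%:Z + k) != j
    & coef D j k < 0].
Proof.
move=> p_gt2 ordD.
pose h k := position G (j%:Z + k) - position G j%:Z.
have [a [a_ge0 selfE]] : exists a, 0 <= a /\ forall k,
    k \in stencil D j -> node_index N (j%:Z + k) = j -> h k ^+ 2 = a.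
  have [/hasP[k0 k0s /eqP k0j]|/hasPn noself] :=
      boolP (has (fun k => node_index N (j%:Z + k) == j) (stencil D j)).
    exists (h k0 ^+ 2); split=> [|k ks kj]; first exact: sqr_ge0.
    rewrite (map_uniq_inj_in (stencil_uniq D j) ks k0s) //.
    by rewrite kj k0j.
  by exists 0; split=> // k /noself /eqP.
have m0 : \sum_(k <- stencil D j) coef D j k = 0.
  rewrite -[RHS](ordD j 0%N) //.
  by apply: eq_bigr => k _; rewrite expr0 mulr1.
have m2 := ordD j 2%N (leqW (ltnW p_gt2)).
have m4 := ordD j 4%N p_gt2.
have [k [ks ha cneg]] := exists_negative_coef (h := h) a_ge0 m0 m2 m4.
by exists k; split=> //; apply: contra ha => /eqP /(selfE _ ks) ->.
Qed.

(** Since a coefficient at another node is negative, a grid function whose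
    strict maximum is at [j] can be given a positive second derivative at [j]
    by taking a very negative value at that other node. *)
Lemma exists_peak_with_positive_apply_op (R : realType) (N : nat)
    (G : grid R N) (D : discrete_op G) (p : nat) (j : 'I_N.+1) :
  (2 < p)%N -> second_derivative_order D p ->
  exists u : 'I_N.+1 -> R,
    [/\ u j = 1, forall i, i != j -> u i <= 0 & 0 < apply_op D u j].
Proof.
move=> p_gt2 ordD.
have [k0 [k0s k0j cneg]] := exists_negative_offdiag j p_gt2 ordD.
set n := node_index N (j%:Z + k0) in k0j.
pose B := \sum_(k <- stencil D j | k != k0)
  coef D j k * (node_index N (j%:Z + k) == j)%:R.
pose T := (`|B| + 1) / coef D j k0.
exists (fun i => if i == n then T else (i == j)%:R); split.
- by rewrite eq_sym (negbTE k0j) eqxx.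
- move=> i /negbTE ij; case: eqP => [_|_]; last by rewrite ij.
  by rewrite ler_ndivrMr // mul0r addr_ge0.
- rewrite /apply_op (bigD1_seq k0) ?(map_uniq (stencil_uniq D j)) //= eqxx.
  rewrite (_ : \sum_(k <- _ | _) _ = B).
    rewrite /T mulrC mulfVK ?lt_eqF //.
    have := ler_norm (- B); rewrite normrN; lra.
  rewrite /B [LHS]big_seq_cond [RHS]big_seq_cond; apply: eq_bigr => k.
  move=> /andP[ks kk0].
  suff /negbTE-> : node_index N (j%:Z + k) != n by [].
  by apply: contra kk0 => /eqP /(map_uniq_inj_in (stencil_uniq D j) ks k0s) ->.
Qed.

Lemma is_derive_expR_scale (R : realType) (a v : R) :
  is_derive v 1 (fun x : R => expR (a * x)) (a * expR (a * v)).
Proof. by apply: is_derive_eq; rewrite /GRing.scale/= mulr1 mulrC. Qed.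

Lemma entropy_expR_scale (R : realType) (a : R) :
  entropy (fun x : R => expR (a * x)).
Proof.
split=> [t x y _ _|v]; last first.
  by have [] := is_derive_expR_scale a v.
have := convex_expR t (a * x) (a * y); rewrite !convRE.
by congr (expR _ <= _); rewrite mulrDr !mulrA ![a * _]mulrC.
Qed.

Theorem theorem4p5 (R : realType) (N : nat) (G : grid R N)
    (D2 : discrete_op G) (p : nat) :
  (2 < p)%N -> second_derivative_order D2 p ->
  exists (U : R -> R) (u : 'I_N.+1 -> R),
    entropy U /\ 0 < \sum_(i < N.+1) derive1 U (u i) * apply_op D2 u i.
Proof.
move=> p_gt2 ordD.
have [u [uj u_le0 V_gt0]] :=
  exists_peak_with_positive_apply_op ord0 p_gt2 ordD.
set V := apply_op D2 u ord0 in V_gt0.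
pose M := \sum_(i < N.+1 | i != ord0) `|apply_op D2 u i|.
have M_ge0 : 0 <= M by apply: sumr_ge0.
(* With this rate, [expR a * V >= (1 + a) * V > M]. *)
pose a := (M + 1) / V.
have a_gt0 : 0 < a by rewrite divr_gt0 // ltr_wpDl.
exists (fun x => expR (a * x)), u; split; first exact: entropy_expR_scale.
under eq_bigr => i _.
  rewrite derive1E (@derive_val _ _ _ _ _ _ _ (is_derive_expR_scale a (u i))).
  rewrite -mulrA; over.
rewrite -mulr_sumr mulr_gt0 // (bigD1 ord0) //= uj mulr1 -/V.
have peak : M < expR a * V.
  have aV : a * V = M + 1 by rewrite mulfVK // gt_eqF.
  have : (1 + a) * V <= expR a * V by rewrite ler_pM2r // expR_ge1Dx.
  rewrite mulrDl mul1r aV; lra.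
suff : - M <= \sum_(i < N.+1 | i != ord0) expR (a * u i) * apply_op D2 u i.
  lra.
rewrite -sumrN; apply: ler_sum => i /u_le0 ui_le0.
rewrite lerNl -mulrN (le_trans (ler_norm _)) // normrM normrN.
rewrite ger0_norm ?expR_ge0 // ler_piMl // -expR0 ler_expR.
by rewrite mulr_ge0_le0 // ltW.
Qed.
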